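(* Let $n\ge m$ be positive integers and let $f:\mathbb{R}^{m\times n}\to\mathbb{R}$ satisfy the standing assumptions listed in the context. Consider the preconditioned heavy-ball iteration $$H_k=\beta H_{k-1}+(1-\beta)\nabla f(x_{k-1}),\qquad x_k=x_{k-1}-\alpha P_k^{-1}H_k,\qquad k\ge 1,$$ where the preconditioners $P_k\in\mathbb{R}^{m\times m}$ are symmetric positive definite and uniformly bounded, i.e. there are constants $p_{\max}>p_{\min}>0$ such that $p_{\min}I\preceq P_k\preceq p_{\max}I$ for all $k$. Then there exist a constant $\beta^\star\in(0,1)$ and a positive function $\alpha^\star:[0,\beta^\star)\to\mathbb{R}_{>0}$ such that for every $\beta\in[0,\beta^\star)$ and every $\alpha\in(0,\alpha^\star(\beta))$ the sequence generated by the iteration satisfies $$\lim_{k\to\infty}\|\nabla f(x_k)\|=0 .$$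
   Context: $\|\cdot\|$ and $\langle\cdot,\cdot\rangle$ denote the Frobenius norm and inner product on matrices, $\nabla f$ is the gradient with respect to this inner product, and $\preceq$ is the Loewner order. Standing assumptions on $f$ (for the problem of minimizing $f$ over $\mathbb{R}^{m\times n}$): $f$ is differentiable and $L$-smooth for some $L>0$, i.e. $\|\nabla f(x)-\nabla f(y)\|\le L\|x-y\|$ for all $x,y$; $f$ is proper, meaning that preimages of compact sets are compact; $f$ is bounded below and attains its minimum value $f^\star$ at some finite point; and $f$ satisfies a global Polyak-Łojasiewicz inequality with some constant $\mu>0$, i.e. $\|\nabla f(x)\|^2\ge\mu(f(x)-f^\star)$ for all $x\in\mathbb{R}^{m\times n}$. Conventions: $\alpha>0$ is the learning rate, $\beta\in[0,1)$ the momentum parameter; the matrices $P_k$ may vary with $k$ and may depend on the iterates; the bounds $p_{\min},p_{\max}$ are fixed before $\beta^\star$ and $\alpha^\star$, which may depend on $p_{\min},p_{\max}$ and $L$. The iteration starts from an initial pair $(x_0,H_0)\in\mathbb{R}^{m\times n}\times\mathbb{R}^{m\times n}$. *)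

(* Defs.v *)
From HB Require Import structures.
From mathcomp Require Import all_boot all_order all_algebra.
From mathcomp Require Import all_classical all_reals all_analysis.

Set Implicit Arguments.
Unset Strict Implicit.
Unset Printing Implicit Defensive.

Import Order.TTheory GRing.Theory Num.Theory.
Import numFieldNormedType.Exports.

Local Open Scope classical_set_scope.
Local Open Scope ring_scope.

(* The norm carried by the library's normed module ['M[R]_(m, n)] is the sup
   norm. Its topology and its derivative are those of the Frobenius norm, but
   metric inequalities have to be stated with [frob_norm]. *)
Definition frob_inner {R : realType} {m n : nat} (A B : 'M[R]_(m, n)) : R :=
  \tr (A^T *m B).

Definition frob_norm {R : realType} {m n : nat} (A : 'M[R]_(m, n)) : R :=
  Num.sqrt (frob_inner A A).

(* Meaningful only where [f] is differentiable; there it is the Riesz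
   representative of ['d f x] for [frob_inner], see [gradientP]. *)
Definition gradient {R : realType} {m n : nat} (f : 'M[R]_(m, n) -> R)
    (x : 'M[R]_(m, n)) : 'M[R]_(m, n) :=
  \matrix_(i, j) 'd f x (delta_mx i j).

Lemma frob_innerE {R : realType} {m n : nat} (A B : 'M[R]_(m, n)) :
  frob_inner A B = \sum_i \sum_j A i j * B i j.
Proof.
rewrite /frob_inner /mxtrace exchange_big; apply: eq_bigr => j _.
by rewrite mxE; apply: eq_bigr => i _; rewrite mxE.
Qed.

Lemma gradientP {R : realType} {m n : nat} (f : 'M[R]_(m, n) -> R)
    (x h : 'M[R]_(m, n)) :
  'd f x h = frob_inner (gradient f x) h.
Proof.
rewrite frob_innerE [in LHS](matrix_sum_delta h) linear_sum.
apply: eq_bigr => i _; rewrite linear_sum; apply: eq_bigr => j _.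
by rewrite linearZ mxE mulrC.
Qed.

Definition lipschitz_gradient {R : realType} {m n : nat} (L : R)
    (f : 'M[R]_(m, n) -> R) : Prop :=
  forall x y : 'M[R]_(m, n),
    frob_norm (gradient f x - gradient f y) <= L * frob_norm (x - y).

Definition proper_map {T U : topologicalType} (f : T -> U) : Prop :=
  forall K : set U, compact K -> compact (f @^-1` K).

Definition polyak_lojasiewicz {R : realType} {m n : nat} (mu : R)
    (f : 'M[R]_(m, n) -> R) (fstar : R) : Prop :=
  forall x : 'M[R]_(m, n),
    mu * (f x - fstar) <= frob_norm (gradient f x) ^+ 2.

(* The minimum value of [f] is written [inf (range f)], which is the greatest
   lower bound only because [range f] is nonempty and bounded below. *)
Record standing_assumptions {R : realType} {m n : nat} (L mu : R)
    (f : 'M[R]_(m, n) -> R) : Prop := StandingAssumptions {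
  sa_differentiable : forall x, differentiable f x;
  sa_smooth : lipschitz_gradient L f;
  sa_proper : proper_map f;
  sa_bounded_below : has_lbound (range f);
  sa_attained : exists x, f x = inf (range f);
  sa_pl : polyak_lojasiewicz mu f (inf (range f)) }.

Definition quad_form {R : realType} {m : nat} (A : 'M[R]_m) (v : 'cV[R]_m) : R :=
  (v^T *m A *m v) 0 0.

Definition posdefmx {R : realType} {m : nat} (A : 'M[R]_m) : Prop :=
  A^T = A /\ forall v : 'cV[R]_m, v != 0 -> 0 < quad_form A v.

Definition possemidefmx {R : realType} {m : nat} (A : 'M[R]_m) : Prop :=
  A^T = A /\ forall v : 'cV[R]_m, 0 <= quad_form A v.

Definition loewner_le {R : realType} {m : nat} (A B : 'M[R]_m) : Prop :=
  possemidefmx (B - A).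

(* The initial pair [(x 0, H 0)] is unconstrained, and [P 0] is not used. *)
Definition heavy_ball {R : realType} {m n : nat} (f : 'M[R]_(m, n) -> R)
    (alpha beta : R) (P : nat -> 'M[R]_m) (x H : nat -> 'M[R]_(m, n)) : Prop :=
  forall k : nat, (1 <= k)%N ->
    H k = beta *: H k.-1 + (1 - beta) *: gradient f (x k.-1) /\
    x k = x k.-1 - alpha *: (invmx (P k) *m H k).

Definition bounded_preconditioners {R : realType} {m : nat} (pmin pmax : R)
    (P : nat -> 'M[R]_m) : Prop :=
  forall k : nat, (1 <= k)%N ->
    [/\ posdefmx (P k), loewner_le pmin%:M (P k) & loewner_le (P k) pmax%:M].

(* Main.v *)
Require Import Defs.
From HB Require Import structures.
From mathcomp Require Import all_boot all_order all_algebra.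
From mathcomp Require Import all_classical all_reals all_analysis.
From mathcomp Require Import ring lra.

(** The proof is a Lyapunov argument. Write [g = gradient f (x k)] and let
    [e = H k - g] be the momentum error, so that [H k.+1 = g + beta *: e]. Three
    facts control one iteration:
    - the [L]-smooth descent lemma ([descent_lemma]) bounds [f (x k.+1)] by the
      inner product of [g] with [invmx (P k.+1) *m H k.+1] and a second-order
      term of size [alpha ^+ 2];
    - the spectral bounds on the preconditioner, used only through the quadratic
      forms of [P], turn that inner product into a decrease proportional to
      [frob_norm g ^+ 2], up to a cross term [beta * frob_norm g * frob_norm e]
      ([frob_inner_invmx_ge], [frob_norm_invmx_le]);
    - the error contracts: the next one is [beta *: e] plus a gradient increment,
      and by smoothness that increment has norm of order [alpha].

    The cross term is the only obstacle to [f (x k)] decreasing. Young's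
    inequality splits it into a fraction of the decrease and a multiple of
    [alpha * frob_norm e ^+ 2], and the latter is absorbed by the contraction of
    [e]. So [f (x k)] plus a suitable multiple of [alpha * frob_norm e ^+ 2]
    decreases by at least [alpha / (4 * pmax) * frob_norm g ^+ 2] at each step
    ([lyapunov_decrease]). It is bounded below because [f] is, hence it converges,
    its decrements tend to zero, and so do the gradients ([cvg_of_lyapunov]).

    The constants obtained are [betastar = 1/2] and
    [alphastar beta = pmin ^+ 2 / (4 * L * pmax)]. *)

Import Order.TTheory GRing.Theory Num.Theory.
Import numFieldNormedType.Exports.

Local Open Scope classical_set_scope.
Local Open Scope ring_scope.

(** * Euclidean geometry of the Frobenius inner product *)

Section FrobeniusGeometry.
Context {R : realType}.

Lemma frob_innerC {m n : nat} (A B : 'M[R]_(m, n)) :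
  frob_inner A B = frob_inner B A.
Proof.
by rewrite !frob_innerE; apply: eq_bigr => i _; apply: eq_bigr => j _; rewrite mulrC.
Qed.

Lemma frob_innerDr {m n : nat} (A B C : 'M[R]_(m, n)) :
  frob_inner A (B + C) = frob_inner A B + frob_inner A C.
Proof. by rewrite /frob_inner mulmxDr mxtraceD. Qed.

Lemma frob_innerZr {m n : nat} (a : R) (A B : 'M[R]_(m, n)) :
  frob_inner A (a *: B) = a * frob_inner A B.
Proof. by rewrite /frob_inner -scalemxAr mxtraceZ. Qed.

Lemma frob_innerDl {m n : nat} (A B C : 'M[R]_(m, n)) :
  frob_inner (A + B) C = frob_inner A C + frob_inner B C.
Proof. by rewrite frob_innerC frob_innerDr !(frob_innerC C). Qed.

Lemma frob_innerZl {m n : nat} (a : R) (A B : 'M[R]_(m, n)) :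
  frob_inner (a *: A) B = a * frob_inner A B.
Proof. by rewrite frob_innerC frob_innerZr frob_innerC. Qed.

Lemma frob_innerNr {m n : nat} (A B : 'M[R]_(m, n)) :
  frob_inner A (- B) = - frob_inner A B.
Proof. by rewrite -scaleN1r frob_innerZr mulN1r. Qed.

Lemma frob_innerNl {m n : nat} (A B : 'M[R]_(m, n)) :
  frob_inner (- A) B = - frob_inner A B.
Proof. by rewrite frob_innerC frob_innerNr frob_innerC. Qed.

Lemma frob_inner_mulmxl {m n : nat} (Q : 'M[R]_m) (A B : 'M[R]_(m, n)) :
  frob_inner (Q *m A) B = frob_inner A (Q^T *m B).
Proof. by rewrite /frob_inner trmx_mul mulmxA. Qed.

Lemma frob_inner_ge0 {m n : nat} (A : 'M[R]_(m, n)) : 0 <= frob_inner A A.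
Proof.
rewrite frob_innerE; apply: sumr_ge0 => i _; apply: sumr_ge0 => j _.
by rewrite -expr2 sqr_ge0.
Qed.

Lemma frob_norm_ge0 {m n : nat} (A : 'M[R]_(m, n)) : 0 <= frob_norm A.
Proof. exact: sqrtr_ge0. Qed.

Lemma sqr_frob_norm {m n : nat} (A : 'M[R]_(m, n)) :
  frob_norm A ^+ 2 = frob_inner A A.
Proof. by rewrite sqr_sqrtr ?frob_inner_ge0. Qed.

Lemma frob_normZ {m n : nat} (a : R) (A : 'M[R]_(m, n)) :
  frob_norm (a *: A) = `|a| * frob_norm A.
Proof.
by rewrite /frob_norm frob_innerZl frob_innerZr mulrA -expr2 sqrtrM ?sqr_ge0// sqrtr_sqr.
Qed.

Lemma frob_norm_eq0 {m n : nat} (A : 'M[R]_(m, n)) : frob_norm A = 0 -> A = 0.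
Proof.
move=> A0; have : frob_inner A A = 0 by rewrite -sqr_frob_norm A0 expr0n.
rewrite frob_innerE => /psumr_eq0P S0; apply/matrixP => i j; rewrite mxE.
have Si : \sum_j A i j * A i j = 0.
  by apply: S0 => // k _; apply: sumr_ge0 => l _; rewrite -expr2 sqr_ge0.
have /eqP : A i j * A i j = 0.
  by apply: (psumr_eq0P _ Si) => // l _; rewrite -expr2 sqr_ge0.
by rewrite mulf_eq0 orbb => /eqP.
Qed.

Lemma frob_cauchy_schwarz {m n : nat} (A B : 'M[R]_(m, n)) :
  frob_inner A B <= frob_norm A * frob_norm B.
Proof.
set a := frob_norm A; set b := frob_norm B.
have [/frob_norm_eq0 A0|a0] := eqVneq a 0.
  by rewrite A0 -(scale0r B) frob_innerZl mul0r mulr_ge0 ?frob_norm_ge0.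
have [/frob_norm_eq0 B0|b0] := eqVneq b 0.
  by rewrite B0 -(scale0r A) frob_innerZr mul0r mulr_ge0 ?frob_norm_ge0.
have ab : 0 < a * b by rewrite mulr_gt0 ?lt0r ?a0 ?b0 ?frob_norm_ge0.
(* Both matrices are rescaled to the norm [a * b], which avoids dividing. *)
have := frob_inner_ge0 (b *: A - a *: B).
rewrite frob_innerDr !frob_innerDl !(frob_innerNl, frob_innerNr, frob_innerZl, frob_innerZr).
rewrite (frob_innerC B A) -!sqr_frob_norm -/a -/b => h.
by rewrite -(ler_pM2l ab); lra.
Qed.

Lemma frob_normD {m n : nat} (A B : 'M[R]_(m, n)) :
  frob_norm (A + B) <= frob_norm A + frob_norm B.
Proof.
rewrite -(@ler_pXn2r _ 2) ?nnegrE ?addr_ge0 ?frob_norm_ge0//.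
rewrite sqr_frob_norm frob_innerDl !frob_innerDr (frob_innerC B A).
by have := frob_cauchy_schwarz A B; rewrite sqrrD !sqr_frob_norm; lra.
Qed.

End FrobeniusGeometry.

(** * Bounds on a preconditioned step *)

Section Preconditioner.
Context {R : realType}.

(** The columns of [A] contribute separately: the left-hand product is the sum of
    the quadratic forms of [Q] at them. This lifts the Loewner order, which is
    about vectors, to the matrices of the iteration. *)
Lemma possemidefmx_frob_ge0 {m n : nat} (Q : 'M[R]_m) (A : 'M[R]_(m, n)) :
  possemidefmx Q -> 0 <= frob_inner A (Q *m A).
Proof.
move=> [_ Q0]; rewrite /frob_inner /mxtrace; apply: sumr_ge0 => j _.
have -> : (A^T *m (Q *m A)) j j = quad_form Q (col j A); last exact: Q0.
rewrite /quad_form -mulmxA !mxE; apply: eq_bigr => i _; rewrite !mxE; congr (_ * _).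
by apply: eq_bigr => k _; rewrite !mxE.
Qed.

Lemma posdefmx_unit {m : nat} (Q : 'M[R]_m) : posdefmx Q -> Q \in unitmx.
Proof.
move=> [_ Q0]; rewrite unitmxE unitfE; apply/negP => /det0P [v v0 vQ].
have := Q0 v^T; rewrite /quad_form trmxK vQ mul0mx mxE ltxx => h.
by have := h _; rewrite trmx_eq0 => /(_ v0).
Qed.

Lemma loewner_le_frob {m n : nat} (P Q : 'M[R]_m) (A : 'M[R]_(m, n)) :
  loewner_le P Q -> frob_inner A (P *m A) <= frob_inner A (Q *m A).
Proof.
move=> /(possemidefmx_frob_ge0 _ A).
by rewrite mulmxBl frob_innerDr frob_innerNr subr_ge0.
Qed.

(** With [w = invmx P *m v], the lower bound on [P] and Cauchy-Schwarz give
    [p * frob_norm w ^+ 2 <= frob_inner w v <= frob_norm w * frob_norm v]. *)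
Lemma frob_norm_invmx_le {m n : nat} (p : R) (P : 'M[R]_m) (v : 'M[R]_(m, n)) :
  0 < p -> posdefmx P -> loewner_le p%:M P ->
  frob_norm (invmx P *m v) <= frob_norm v / p.
Proof.
move=> p0 Ppos pP; set w := invmx P *m v.
have Pw : P *m w = v by rewrite mulKVmx// posdefmx_unit.
have := loewner_le_frob _ _ w pP; rewrite Pw mul_scalar_mx frob_innerZr -sqr_frob_norm.
have := frob_cauchy_schwarz w v => h1 h2.
have [->|w0] := eqVneq (frob_norm w) 0; first by rewrite divr_ge0 ?frob_norm_ge0 ?ltW.
have wp : 0 < frob_norm w by rewrite lt0r w0 frob_norm_ge0.
rewrite ler_pdivlMr// -(ler_pM2l wp); lra.
Qed.

(** The value of [frob_inner v (invmx P *m v)] is the maximum over [z] of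
    [2 * frob_inner v z - frob_inner z (P *m z)], and [z = q^-1 *: v] already
    gives the bound. The excess over this [z] is the form of [P] at
    [invmx P *m v - z]. *)
Lemma frob_inner_invmx_ge {m n : nat} (q : R) (P : 'M[R]_m) (v : 'M[R]_(m, n)) :
  0 < q -> posdefmx P -> loewner_le P q%:M ->
  frob_norm v ^+ 2 / q <= frob_inner v (invmx P *m v).
Proof.
move=> q0 Ppos Pq; set w := invmx P *m v.
have Pw : P *m w = v by rewrite mulKVmx// posdefmx_unit.
have PT : P^T = P by case: Ppos.
have Pvw : frob_inner w (P *m v) = frob_norm v ^+ 2.
  by rewrite -{1}PT -frob_inner_mulmxl Pw sqr_frob_norm.
have Psemi : possemidefmx P.
  split=> // u; have [->|u0] := eqVneq u 0; last by apply: ltW; case: Ppos => _; exact.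
  by rewrite /quad_form mulmx0 mxE.
have := possemidefmx_frob_ge0 _ (w - q^-1 *: v) Psemi.
rewrite mulmxBr -scalemxAr Pw frob_innerDr !frob_innerDl.
rewrite !(frob_innerNl, frob_innerNr, frob_innerZl, frob_innerZr) Pvw.
have := loewner_le_frob _ _ v Pq; rewrite mul_scalar_mx frob_innerZr -!sqr_frob_norm.
rewrite (frob_innerC w v) => h1 h2.
have h3 : q^-1 * (q^-1 * frob_inner v (P *m v)) <= q^-1 * frob_norm v ^+ 2.
  rewrite ler_pM2l ?invr_gt0// -(ler_pM2l q0) mulrA mulfV ?gt_eqF// mul1r.
  exact: h1.
by lra.
Qed.

End Preconditioner.

(** * The descent lemma *)

Section Descent.
Context {R : realType} {m n : nat}.

Lemma is_derive_line (f : 'M[R]_(m, n) -> R) (x h : 'M[R]_(m, n)) (t : R) :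
  differentiable f (t *: h + x) ->
  is_derive t 1 (fun s : R => f (s *: h + x))
    (frob_inner (gradient f (t *: h + x)) h).
Proof.
move=> df.
pose g : R -> 'M[R]_(m, n) := fun s => s *: h + x.
have dg : is_diff t g (( *:%R^~ h) + 0) by exact: is_diffD.
have dF := is_diff_comp dg (differentiableP df).
apply: DeriveDef; first exact/diff_derivable/ex_diff.
rewrite deriveE; last exact: ex_diff.
rewrite [LHS](congr1 (@^~ 1) (@diff_val _ _ _ _ _ _ _ dF)).
have E : (( *:%R^~ h : R -> 'M[R]_(m, n)) + 0) 1 = h by rewrite addr0 /= scale1r.
by rewrite -gradientP /= E.
Qed.

(** The function [phi] below subtracts from [f], along the segment from [x] to
    [x + h], its first-order part and the quadratic [d * t ^+ 2]; smoothness
    makes the slope of [phi] nonpositive on the segment, so [phi 1 <= phi 0]. *)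
Lemma descent_lemma (L : R) (f : 'M[R]_(m, n) -> R) (x h : 'M[R]_(m, n)) :
  (forall y, differentiable f y) -> lipschitz_gradient L f ->
  f (x + h) <= f x + frob_inner (gradient f x) h + L / 2 * frob_norm h ^+ 2.
Proof.
move=> df lf.
pose c := frob_inner (gradient f x) h; pose d := L / 2 * frob_norm h ^+ 2.
pose phi := fun t : R => f (t *: h + x) - c * t - d * t ^+ 2.
pose dphi := fun t : R => frob_inner (gradient f (t *: h + x)) h - c - d * (2 * t).
have dP (t : R) : is_derive t 1 phi (dphi t).
  have dl := is_derive_line f x h t (df (t *: h + x)).
  rewrite /phi /dphi.
  apply: is_derive_eq.
  by rewrite /GRing.scale /= !mulr1 mulr_natl mulr2n.
have [t] : exists2 t, t \in `]0, 1[ & phi 1 - phi 0 = dphi t * (1 - 0).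
  apply: MVT => //; apply: derivable_within_continuous => t _.
  by case: (dP t).
rewrite in_itv/= => /andP[t0 t1].
rewrite /phi /dphi subr0 mulr1 scale1r scale0r add0r (addrC h x) => E.
have slope : frob_inner (gradient f (t *: h + x)) h - c <= d * (2 * t).
  have -> : frob_inner (gradient f (t *: h + x)) h - c =
      frob_inner (gradient f (t *: h + x) - gradient f x) h.
    by rewrite frob_innerDl frob_innerNl.
  apply: le_trans (frob_cauchy_schwarz _ _) _.
  have := lf (t *: h + x) x; rewrite addrK frob_normZ gtr0_norm// => hl.
  apply: le_trans (ler_wpM2r (frob_norm_ge0 h) hl) _.
  by rewrite /d; move: (frob_norm h) => s; clear -L; lra.
change (f (x + h) <= f x + c + d); move: E slope {phi dphi dP}.
move: (f (x + h)) (f x) (frob_inner _ h) c d => r s e c d; lra.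
Qed.

End Descent.

(** * The Lyapunov function *)

(** [V] is nonincreasing and bounded below, so it converges and its decrements,
    which dominate [c * u k ^+ 2], tend to zero. *)
Lemma cvg_of_lyapunov {R : realType} (V u : R ^nat) (b c : R) :
  0 < c -> (forall k, 0 <= u k) -> (forall k, b <= V k) ->
  (forall k, V k.+1 <= V k - c * u k ^+ 2) -> u @ \oo --> (0 : R).
Proof.
move=> c0 u0 bV VS.
have Vcv : cvgn V.
  apply: nonincreasing_is_cvgn; last by exists b => _ [k _ <-].
  apply/nonincreasing_seqP => k; apply: le_trans (VS k) _.
  by rewrite gerBl mulr_ge0 ?sqr_ge0 // ltW.
have D : (fun k => c^-1 * (V k - V k.+1)) @ \oo --> (0 : R).
  rewrite -(mulr0 c^-1) -(subrr (limn V)); apply: cvgM; [exact: cvg_cst | apply: cvgB => //].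
  by rewrite cvg_shiftS.
have U2 : (fun k => u k ^+ 2) @ \oo --> (0 : R).
  apply: (squeeze_cvgr _ (cvg_cst 0) D); apply: nearW => k.
  by rewrite sqr_ge0 ler_pdivlMl//= lerBrDl -lerBrDr.
rewrite -(sqrtr0 R); have -> : u = (fun k => Num.sqrt (u k ^+ 2)).
  by apply/funext => k; rewrite sqrtr_sqr ger0_norm.
exact: (cvg_comp _ _ U2 (@sqrt_continuous R 0)).
Qed.

(** The scalar inequality behind the decrease, after division by [alpha / pmax].
    Here [u] and [w] are the norms of the gradient and of the momentum error, [w']
    is the norm of the next error, [kappa] is the ratio [pmax / pmin]
    and [a = L * alpha / pmin]. Of the decrease [u ^+ 2], one quarter pays for each
    of the cross term, the curvature term and the new error [w'], and one quarter
    is left. In units of [(kappa * w) ^+ 2] these cost [1/4], [1/16] and [25/16],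
    together less than the [2] that the old error provides. *)
Lemma lyapunov_coefficients {R : realType} (a beta kappa u w w' : R) :
  0 <= a -> 0 <= beta <= 1/2 -> 1 <= kappa -> a * kappa <= 1/4 ->
  0 <= u -> 0 <= w -> 0 <= w' -> w' <= beta * w + a * (u + beta * w) ->
  - u ^+ 2 + beta * kappa * (u * w) + a * kappa / 2 * (u + beta * w) ^+ 2
    + 2 * kappa ^+ 2 * (w' ^+ 2 - w ^+ 2) <= - (u ^+ 2 / 4).
Proof.
move=> a0 /andP[b0 b1] k1 ak u0 w0 w'0 hw.
have cross : beta * kappa * (u * w) <= u ^+ 2 / 4 + (kappa * w) ^+ 2 / 4.
  have := sqr_ge0 (u / 2 - beta * (kappa * w)).
  have : beta ^+ 2 * (kappa * w) ^+ 2 <= (1/2) ^+ 2 * (kappa * w) ^+ 2.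
    by rewrite ler_wpM2r ?sqr_ge0// ler_pXn2r ?nnegrE//; lra.
  by lra.
have bw : beta * w <= w / 2 by have := ler_wpM2r w0 b1; lra.
have bw0 : 0 <= beta * w by rewrite mulr_ge0.
have kw : w <= kappa * w by have := ler_wpM2r w0 k1; lra.
have curv : a * kappa / 2 * (u + beta * w) ^+ 2 <= u ^+ 2 / 4 + (kappa * w) ^+ 2 / 16.
  have s1 : (u + beta * w) ^+ 2 <= 2 * u ^+ 2 + w ^+ 2 / 2.
    have := sqr_ge0 (u - w / 2).
    have : (u + beta * w) ^+ 2 <= (u + w / 2) ^+ 2 by rewrite ler_pXn2r ?nnegrE//; lra.
    by lra.
  have s2 : w ^+ 2 <= (kappa * w) ^+ 2 by rewrite ler_pXn2r ?nnegrE//; lra.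
  have s3 := ler_wpM2r (sqr_ge0 (u + beta * w)) ak.
  by lra.
have mom : kappa * w' <= 5/8 * (kappa * w) + u / 4.
  have s1 : kappa * w' <= kappa * (beta * w + a * (u + beta * w)).
    by rewrite ler_wpM2l//; lra.
  have s2 := ler_wpM2l (le_trans ler01 k1) bw.
  have s3 : (a * kappa) * (u + beta * w) <= 1/4 * (u + kappa * w / 2).
    apply: ler_pM => //; [by rewrite mulr_ge0//; lra | lra | lra].
  by lra.
have mom2 : (kappa * w') ^+ 2 <= 25/32 * (kappa * w) ^+ 2 + u ^+ 2 / 8.
  have := sqr_ge0 (5/8 * (kappa * w) - u / 4).
  have : (kappa * w') ^+ 2 <= (5/8 * (kappa * w) + u / 4) ^+ 2.
    by rewrite ler_pXn2r ?nnegrE//; [rewrite mulr_ge0//; lra | lra].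
  by lra.
have := sqr_ge0 (kappa * w); lra.
Qed.

Section Lyapunov.
Context {R : realType} {m n : nat}.

(** The weight of the momentum error is proportional to [alpha], as is the cross
    term it has to absorb; the factor [2] covers the total of the costs counted in
    [lyapunov_coefficients]. *)
Definition lyapunov (pmin pmax alpha : R) (f : 'M[R]_(m, n) -> R)
    (x h : 'M[R]_(m, n)) : R :=
  f x + 2 * pmax / pmin ^+ 2 * alpha * frob_norm (h - gradient f x) ^+ 2.

Lemma lyapunov_decrease (L pmin pmax alpha beta : R) (f : 'M[R]_(m, n) -> R)
    (P : 'M[R]_m) (x x' h h' : 'M[R]_(m, n)) :
  0 < L -> 0 < pmin -> pmin < pmax -> 0 <= beta <= 1/2 ->
  0 < alpha <= pmin ^+ 2 / (4 * L * pmax) ->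
  (forall y, differentiable f y) -> lipschitz_gradient L f ->
  posdefmx P -> loewner_le pmin%:M P -> loewner_le P pmax%:M ->
  h' = beta *: h + (1 - beta) *: gradient f x ->
  x' = x - alpha *: (invmx P *m h') ->
  lyapunov pmin pmax alpha f x' h' <=
  lyapunov pmin pmax alpha f x h - alpha / (4 * pmax) * frob_norm (gradient f x) ^+ 2.
Proof.
move=> L0 p0 pq b01 /andP[a0 aub] df lf Ppos pP Pq h'E x'E.
have q0 : 0 < pmax := lt_trans p0 pq.
have [b0 _] := andP b01.
set g := gradient f x; set e := h - g; set d := invmx P *m h'.
set u := frob_norm g; set w := frob_norm e.
set w' := frob_norm (h' - gradient f x').
have h'ge : h' = g + beta *: e.
  by rewrite h'E /e scalerBr scalerBl scale1r addrCA addrC -/g -addrA.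
have h'n : frob_norm h' <= u + beta * w.
  rewrite h'ge; apply: le_trans (frob_normD _ _) _.
  by rewrite frob_normZ ger0_norm.
have dn : frob_norm d <= (u + beta * w) / pmin.
  apply: le_trans (frob_norm_invmx_le _ _ _ p0 Ppos pP) _.
  by rewrite ler_pM2r ?invr_gt0.
(* The main term has the exact gradient, the cross term is the effect of [e]. *)
have gd : u ^+ 2 / pmax - beta * (u * w) / pmin <= frob_inner g d.
  rewrite /d h'ge mulmxDr -scalemxAr frob_innerDr.
  apply: lerD; first exact: frob_inner_invmx_ge.
  rewrite lerNl -frob_innerNr -scalerN frob_innerZr -mulrA ler_wpM2l//.
  apply: le_trans (frob_cauchy_schwarz _ _) _.
  rewrite -mulrA ler_wpM2l ?frob_norm_ge0// -scaleN1r frob_normZ normrN1 mul1r.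
  exact: frob_norm_invmx_le.
have fx' : f x' <= f x - alpha * frob_inner g d + L / 2 * (alpha * frob_norm d) ^+ 2.
  have := descent_lemma L f x (- alpha *: d) df lf.
  by rewrite frob_innerZr frob_normZ normrN (gtr0_norm a0) scaleNr -x'E mulNr.
have w'n : w' <= beta * w + L * alpha / pmin * (u + beta * w).
  have -> : w' = frob_norm (beta *: e + (g - gradient f x')).
    by rewrite /w' h'ge; congr frob_norm; rewrite addrAC addrC.
  apply: le_trans (frob_normD _ _) _; rewrite frob_normZ ger0_norm// lerD2l.
  apply: le_trans (lf _ _) _; rewrite x'E opprB addrC subrK frob_normZ gtr0_norm//.
  rewrite -!mulrA ler_pM2l// ler_pM2l// [leRHS]mulrC.
  exact: dn.
have kappa1 : 1 <= pmax / pmin by rewrite ler_pdivlMr// mul1r ltW.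
have ak : L * alpha / pmin * (pmax / pmin) <= 1/4.
  have := aub; rewrite ler_pdivlMr ?mulr_gt0// => aub'.
  have -> : L * alpha / pmin * (pmax / pmin) = (alpha * (4 * L * pmax)) / (4 * pmin ^+ 2).
    by field; rewrite gt_eqF.
  by rewrite ler_pdivrMr ?mulr_gt0 ?exprn_gt0//; lra.
have a_ge0 : 0 <= L * alpha / pmin by rewrite divr_ge0 ?mulr_ge0 ?ltW.
have key := lyapunov_coefficients _ _ _ u w w' a_ge0 b01 kappa1 ak
  (frob_norm_ge0 _) (frob_norm_ge0 _) (frob_norm_ge0 _) w'n.
have dn2 : (alpha * frob_norm d) ^+ 2 <= (alpha * ((u + beta * w) / pmin)) ^+ 2.
  rewrite lerXn2r ?ler_pM2l// nnegrE.
    exact: (mulr_ge0 (ltW a0) (frob_norm_ge0 d)).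
  exact: (mulr_ge0 (ltW a0) (le_trans (frob_norm_ge0 d) dn)).
have fx'2 : f x' <= f x - alpha * (u ^+ 2 / pmax - beta * (u * w) / pmin)
    + L / 2 * (alpha * ((u + beta * w) / pmin)) ^+ 2.
  apply: le_trans fx' _; apply: lerD.
    by rewrite lerD2l lerN2 ler_pM2l.
  by rewrite ler_pM2l// divr_gt0.
(* Undo the normalization of [lyapunov_coefficients]; what remains is an identity. *)
rewrite -(ler_pM2l (divr_gt0 a0 q0)) in key.
change (f x' + 2 * pmax / pmin ^+ 2 * alpha * w' ^+ 2 <=
  f x + 2 * pmax / pmin ^+ 2 * alpha * w ^+ 2 - alpha / (4 * pmax) * u ^+ 2).
apply: le_trans (lerD fx'2 (lexx _)) _.
rewrite -subr_le0; rewrite -subr_le0 in key; apply: le_trans key.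
rewrite le_eqVlt; apply/orP; left; apply/eqP.
move: (f x) (u) (w) (w') => F U W W'.
by field; rewrite !gt_eqF.
Qed.

End Lyapunov.

Theorem theorem1 (R : realType) (m n : nat) (hm : (0 < m)%N) (hmn : (m <= n)%N)
    (L pmin pmax : R) (hL : 0 < L) (hpmin : 0 < pmin) (hpmax : pmin < pmax) :
  exists betastar : R, 0 < betastar < 1 /\
  exists alphastar : R -> R,
    (forall beta : R, 0 <= beta < betastar -> 0 < alphastar beta) /\
    forall (f : 'M[R]_(m, n) -> R) (mu : R),
      0 < mu -> standing_assumptions L mu f ->
    forall beta : R, 0 <= beta < betastar ->
    forall alpha : R, 0 < alpha < alphastar beta ->
    forall (P : nat -> 'M[R]_m) (x H : nat -> 'M[R]_(m, n)),
      bounded_preconditioners pmin pmax P ->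
      heavy_ball f alpha beta P x H ->
      (fun k : nat => frob_norm (gradient f (x k))) @ \oo --> (0 : R).
Proof.
have q0 : 0 < pmax := lt_trans hpmin hpmax.
exists (1/2); split; first lra.
exists (fun=> pmin ^+ 2 / (4 * L * pmax)); split.
  by move=> beta _; rewrite divr_gt0 ?mulr_gt0 ?exprn_gt0.
move=> f mu _ [df lf _ f_lb _ _] beta /andP[b0 b1] alpha /andP[a0 a1] P x H hP hHB.
apply: (cvg_of_lyapunov (fun k => lyapunov pmin pmax alpha f (x k) (H k)) _
  (inf (range f)) (alpha / (4 * pmax))).
- by rewrite divr_gt0 ?mulr_gt0.
- by move=> k; exact: frob_norm_ge0.
- move=> k; apply: (@le_trans _ _ (f (x k))); first by apply: ge_inf => //; exists (x k).
  rewrite /lyapunov lerDl; apply: mulr_ge0; last exact: sqr_ge0.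
  by rewrite ltW// mulr_gt0// divr_gt0 ?exprn_gt0// mulr_gt0.
- move=> k; have [Hk xk] := hHB k.+1 isT; have [Ppos pP Pq] := hP k.+1 isT.
  apply: (lyapunov_decrease L _ _ _ beta _ (P k.+1)) => //.
    by rewrite b0 ltW.
  by rewrite a0 ltW.
Qed.
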